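(* There exists $x\in\mathscr{Z}$ such that $x\not\sim y$ for all $y\in\mathscr{Y}$.
   Context: $\mathbf{N}$ denotes the set of positive integers. $\mathscr{X}$ is the set of all sequences $x=(x_n)_{n\in\mathbf{N}}$ of strictly positive real numbers such that $\sum_n x_n=\infty$. For $x\in\mathscr{X}$, let $\mathcal{I}_x:=\{A\subseteq\mathbf{N} : \sum_{n\in A}x_n<\infty\}$. For $x,y\in\mathscr{X}$, write $x\sim y$ if $\mathcal{I}_x=\mathcal{I}_y$, i.e., if for all $A\subseteq\mathbf{N}$, $\sum_{n\in A}x_n<\infty$ if and only if $\sum_{n\in A}y_n<\infty$. Define $\mathscr{Z}:=\{x\in\mathscr{X} : \lim_{n\to\infty}x_n=0\}$ and $\mathscr{Y}:=\{y\in\mathscr{X} : \liminf_{n\to\infty} y_{n+1}/y_n>0\}$. *)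

(* Defs.v *)
From HB Require Import structures.
From mathcomp Require Import all_boot all_order all_algebra.
From mathcomp Require Import all_classical all_reals all_analysis.
Import Order.TTheory GRing.Theory Num.Theory.
Import numFieldNormedType.Exports.

Set Implicit Arguments.
Unset Strict Implicit.
Unset Printing Implicit Defensive.

Local Open Scope classical_set_scope.
Local Open Scope ring_scope.

(* A sequence (x_n) indexed by the positive integers is represented by
   x : R^nat, with x n standing for x_(n+1); likewise a set of positive
   integers is represented by its translate in nat. *)

Section summable_ideals.
Variable R : realType.
Implicit Types x y : R^nat.

Definition scrX : set (R^nat) :=
  [set x | (forall n, 0 < x n) /\ (\sum_(n <oo) (x n)%:E = +oo)%E].

Definition ideal x : set (set nat) :=
  [set A : set nat | (\sum_(n <oo | n \in A) (x n)%:E < +oo)%E].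

Definition ideal_equiv x y : Prop := ideal x = ideal y.

Definition scrZ : set (R^nat) := [set x | scrX x /\ x @ \oo --> 0].

(* The liminf is taken in \bar R, since the ratios may be unbounded, in which
   case it can be +oo. *)
Definition scrY : set (R^nat) :=
  [set y | scrX y /\ (0 < limn_einf (fun n => (y n.+1 / y n)%:E))%E].

End summable_ideals.

(* Main.v *)
(** Let [x] be summable along the odd indices, non-summable along the even ones,
    and null. If [liminf y_(n+1)/y_n > 0], then [y_n <= C y_(n+1)] for all [n],
    so that [y], if summable along the odd indices, is also summable along their
    predecessors, the even ones. Hence [x] and [y] have different ideals. *)

Require Import Defs.
From HB Require Import structures.
From mathcomp Require Import all_boot all_order all_algebra.
From mathcomp Require Import all_classical all_reals all_analysis.
Import Order.TTheory GRing.Theory Num.Theory.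
Import numFieldNormedType.Exports.
Local Open Scope classical_set_scope.
Local Open Scope ring_scope.

(** The partial sums are nondecreasing, so their failure to converge in [R] forces the limit
    [+oo]. *)
Lemma nneseries_harmonic (R : realType) :
  (\sum_(n <oo) (@harmonic R n)%:E = +oo)%E.
Proof.
apply/cvg_lim => //.
rewrite (_ : (fun n => _) = EFin \o series (@harmonic R)); last first.
  by apply/funext => n /=; rewrite sumEFin.
apply/cvgeryP/nondecreasing_dvgn_lt; last exact: dvg_harmonic.
by apply: nondecreasing_series => n _ _; exact: harmonic_ge0.
Qed.

(** A series of nonnegative terms is an unordered sum, hence can be reindexed along the bijection
    [k |-> k.*2] onto the even numbers. *)
Lemma nneseries_double (R : realType) (f : nat -> \bar R) :
  (forall n, 0 <= f n)%E ->
  (\sum_(n <oo | n \in [set n | ~~ odd n]) f n = \sum_(k <oo) f k.*2)%E.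
Proof.
move=> f0; rewrite nneseries_esum// nneseries_esumT//.
apply: (reindex_esum _ _ (fun k => k.*2)); split.
- by move=> k _ /=; rewrite inE /= odd_double.
- by move=> i j _ _; exact: double_inj.
- move=> n /=; rewrite inE /= => en; exists n./2 => //.
  by rewrite -[RHS]odd_double_half (negbTE en).
Qed.

Lemma nneseries_doubleS (R : realType) (f : nat -> \bar R) :
  (forall n, 0 <= f n)%E ->
  (\sum_(n <oo | n \in [set n | odd n]) f n = \sum_(k <oo) f k.*2.+1)%E.
Proof.
move=> f0; rewrite nneseries_esum// nneseries_esumT//.
apply: (reindex_esum _ _ (fun k => k.*2.+1)); split.
- by move=> k _ /=; rewrite inE /= odd_double.
- by move=> i j _ _ [] /double_inj.
- move=> n /=; rewrite inE /= => on; exists n./2 => //.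
  by rewrite -[RHS]odd_double_half on.
Qed.

(** The lower limit is the supremum of the tail infima, so one of these is already positive; it is
    finite, being bounded by a term of [u], and serves as [c]. *)
Lemma limn_einf_gt0_near (R : realType) (u : R^nat) :
  (0 < limn_einf (fun n => (u n)%:E))%E ->
  exists2 c : R, 0 < c & \forall n \near \oo, c <= u n.
Proof.
rewrite limn_einf_lim; have /cvg_lim -> // := @cvg_einfs_sup R (fun n => (u n)%:E).
move=> /ereal_sup_gt.
move=> [_ [N _ <-]]; set e := einfs _ N => e_gt0.
have le_e n : (N <= n)%N -> (e <= (u n)%:E)%E.
  by move=> Nn; apply: ereal_inf_lbound; exists n.
have e_fin : e \is a fin_num.
  by rewrite ge0_fin_numE ?(ltW e_gt0)// (le_lt_trans (le_e N (leqnn N)))// ltry.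
exists (fine e); first by rewrite fine_gt0// e_gt0 ltey_eq e_fin.
by exists N => // n /= Nn; rewrite -lee_fin fineK// le_e.
Qed.

Lemma scrY_le_next (R : realType) (y : R^nat) : scrY y ->
  exists2 C : R, 0 <= C & forall n, y n <= C * y n.+1.
Proof.
move=> [[y0 _] /(@limn_einf_gt0_near _ (fun n => y n.+1 / y n))].
move=> [c c0 [N _ cN]].
have r0 i : 0 <= y i / y i.+1 by rewrite divr_ge0// ltW.
have s0 : 0 <= \sum_(i < N) y i / y i.+1 by apply: sumr_ge0.
(* [c^-1] bounds the ratios [y n / y n.+1] from [N] on; the sum bounds each of the finitely many
   earlier ones. *)
exists (c^-1 + \sum_(i < N) y i / y i.+1).
  by rewrite addr_ge0// invr_ge0 ltW.
move=> n; rewrite -ler_pdivrMr//; have [nN|Nn] := ltnP n N.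
  rewrite (bigD1 (Ordinal nN))//= addrCA lerDl addr_ge0//.
    by rewrite invr_ge0 ltW.
  by apply: sumr_ge0.
rewrite ler_wpDr// -[leLHS]invrK invf_div lef_pV2 ?posrE ?divr_gt0//.
exact: cN.
Qed.

Lemma scrY_ideal_even (R : realType) (y : R^nat) : scrY y ->
  ideal y [set n | odd n] -> ideal y [set n | ~~ odd n].
Proof.
move=> yY; have [[y0 _] _] := yY; have [C C0 yC] := scrY_le_next _ _ yY.
have ye n : (0 <= (y n)%:E)%E by rewrite lee_fin ltW.
rewrite /ideal /= nneseries_double// nneseries_doubleS// => odd_lty.
(* Each even index [k.*2] is charged to its odd successor. *)
apply: (@le_lt_trans _ _ (\sum_(k <oo) (C%:E * (y k.*2.+1)%:E))%E).
  by apply: lee_nneseries => // n _; rewrite -EFinM lee_fin.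
by rewrite nneseriesZl// lte_mul_pinfty.
Qed.

(** The odd branch is written as the general term of the geometric series in
    [cvg_geometric_eseries_half]. *)
Definition alternating (R : realType) : R^nat :=
  fun n => if odd n then 1 / (2 ^ (n + 1))%:R else harmonic n.

Lemma alternating_gt0 (R : realType) n : 0 < alternating R n.
Proof.
rewrite /alternating; case: ifP => _; last exact: harmonic_gt0.
by rewrite divr_gt0 ?ltr0n ?expn_gt0.
Qed.

Lemma alternating_odd (R : realType) : ideal (alternating R) [set n | odd n].
Proof.
have p0 n : (0 <= ((1 : R) / (2 ^ (n + 1))%:R)%:E)%E by rewrite lee_fin divr_ge0.
rewrite /ideal /=.
apply: (@le_lt_trans _ _ (\sum_(n <oo) ((1 : R) / (2 ^ (n + 1))%:R)%:E)%E).
  rewrite eseries_mkcond; apply: lee_nneseries => n.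
    by case: ifP => // _; rewrite lee_fin ltW// alternating_gt0.
  by case: ifP => // /set_mem /= odd_n _; rewrite /alternating odd_n.
have /cvg_lim -> // := @cvg_geometric_eseries_half R 1 0.
exact: ltry.
Qed.

Lemma alternating_even (R : realType) :
  (\sum_(n <oo | n \in [set n | ~~ odd n]) (alternating R n)%:E = +oo)%E.
Proof.
rewrite nneseries_double => [|n]; last by rewrite lee_fin ltW// alternating_gt0.
apply/eqP; rewrite -leye_eq.
(* Comparison with half the harmonic series: [1 / (2k + 1) >= 1 / (2k + 2)]. *)
have <- : (\sum_(k <oo) (2^-1%:E * (@harmonic R k)%:E) = +oo)%E.
  rewrite nneseriesZl => [|i _]; last by rewrite lee_fin harmonic_ge0.
  by rewrite nneseries_harmonic gt0_muley// lte_fin invr_gt0.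
apply: lee_nneseries => n.
  by rewrite -EFinM lee_fin mulr_ge0 ?invr_ge0 ?harmonic_ge0.
rewrite -EFinM lee_fin /alternating odd_double /= -invfM lef_pV2 ?posrE//.
by rewrite -natrM ler_nat mul2n doubleS ltnS leqnSn.
Qed.

Lemma alternating_scrZ (R : realType) : scrZ (alternating R).
Proof.
split; first split.
- exact: alternating_gt0.
(* The even-indexed part alone already diverges. *)
- apply/eqP; rewrite -leye_eq -(alternating_even R) eseries_mkcond.
  apply: lee_nneseries => n.
    by case: ifP => // _; rewrite lee_fin ltW// alternating_gt0.
  by case: ifP => // _ _; rewrite lee_fin ltW// alternating_gt0.
(* The harmonic sequence dominates at odd indices too, since [n + 1 < 2 ^ (n + 1)]. *)
- apply: (@squeeze_cvgr _ _ _ _ (cst 0) (@harmonic R)).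
  + apply: nearW => n; rewrite ltW ?alternating_gt0//= /alternating.
    case: ifP => // _; rewrite div1r lef_pV2 ?posrE ?ltr0n ?expn_gt0//.
    by rewrite ler_nat -addn1 ltnW// ltn_expl.
  + exact: cvg_cst.
  + exact: cvg_harmonic.
Qed.

Theorem theorem1p3 (R : realType) :
  exists x : R^nat, scrZ x /\ forall y : R^nat, scrY y -> ~ ideal_equiv x y.
Proof.
exists (alternating R); split; first exact: alternating_scrZ.
move=> y yY xy; have := alternating_odd R; rewrite xy.
(* Carried back to the ideal of [alternating R], membership of the even numbers reads
   [+oo < +oo]. *)
by move=> /(scrY_ideal_even _ _ yY); rewrite -xy /ideal /= alternating_even ltxx.
Qed.
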